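(* Let $q$ be an odd prime power and let $P\ne Q$ be points of $S$. (i) $P$ and $Q$ (as quadratic polynomials) have a common root if and only if $P,Q\in T_r$ for some $r\in\mathbb F_q$; equivalently, the line $PQ$ is tangent to $\Pi$. (ii) The pair $(P,Q)$ is aligned if and only if the line $PQ$ is vertical. (iii) Three distinct points of $S$ satisfy $\mathfrak d=0$ if and only if they are collinear.
   Context: The monic quadratic $x^2+ax+b\in\mathbb F_q[x]$ is identified with the point $(a,b)\in\mathbb A^2(\mathbb F_q)$. $\Pi$ is the discriminant parabola $b=a^2/4$, and $S=\mathbb A^2(\mathbb F_q)\setminus\Pi$, i.e. the set of separable monic quadratics. Common roots are taken in an algebraic closure of $\mathbb F_q$. For $r\in\mathbb F_q$, $T_r=\{(a,b): (x-r)\mid x^2+ax+b\}=\{(a,b): b=-ra-r^2\}$; this line is the tangent to $\Pi$ at $(-2r,r^2)$. A line is vertical if it has the form $a=\text{const}$; vertical lines are not called tangent. A pair of monic quadratics $x^2+a_1x+a_0$, $x^2+b_1x+b_0$ is aligned if the bracket $a'b-ab'$ (derivatives in $x$) has degree less than $2$, equivalently $a_1=b_1$. For $u=x^2+u_1x+u_0$, $v=x^2+v_1x+v_0$, $w=x^2+w_1x+w_0$, $$\mathfrak d(u,v,w)=\det\begin{pmatrix} u_0 & u_1 & 1 \\ v_0 & v_1 & 1 \\ w_0 & w_1 & 1 \end{pmatrix}.$$ *)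

(* Defs.v *)
From HB Require Import structures.
From mathcomp Require Import all_boot all_order all_algebra all_field.

Set Implicit Arguments.
Unset Strict Implicit.
Unset Printing Implicit Defensive.

Import GRing.Theory.
Local Open Scope ring_scope.

(* The point p = (a, b) stands for the monic quadratic x^2 + a x + b, so p.1 is
   the coefficient of x and p.2 is the constant term. *)
Definition quad (F : finFieldType) (p : F * F) : {poly F} :=
  'X^2 + p.1 *: 'X + p.2%:P.

(* The discriminant parabola is the graph b = a^2 / 4 of this polynomial. *)
Definition parab (F : finFieldType) : {poly F} := 4%:R^-1 *: 'X^2.

Definition Disc (F : finFieldType) : {set F * F} :=
  [set p | p.2 == (parab F).[p.1]].

Definition Sep (F : finFieldType) : {set F * F} := ~: Disc F.

Definition Tline (F : finFieldType) (r : F) : {set F * F} :=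
  [set p | ('X - r%:P) %| quad p].

Definition is_algebraic_closure (F : finFieldType) (K : closedFieldType)
    (iota : {rmorphism F -> K}) : Prop :=
  integralRange iota.

Definition common_root (F : finFieldType) (K : closedFieldType)
    (iota : {rmorphism F -> K}) (f g : {poly F}) : Prop :=
  exists x : K, root (map_poly iota f) x /\ root (map_poly iota g) x.

(* A genuine line only when P != Q. *)
Definition line_through (F : finFieldType) (P Q : F * F) : {set F * F} :=
  [set (P.1 + t * (Q.1 - P.1), P.2 + t * (Q.2 - P.2)) | t : F].

Definition collinear (F : finFieldType) (A B C : F * F) : Prop :=
  exists P Q : F * F,
    P != Q /\ [/\ A \in line_through P Q, B \in line_through P Q
                & C \in line_through P Q].

Definition vertical (F : finFieldType) (L : {set F * F}) : Prop :=
  exists c : F, L = [set p | p.1 == c].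

(* The tangent at p to the graph of parab; it is never vertical. *)
Definition tangent_at (F : finFieldType) (p : F * F) : {set F * F} :=
  [set x | x.2 == p.2 + (parab F)^`().[p.1] * (x.1 - p.1)].

Definition tangent_to_Disc (F : finFieldType) (L : {set F * F}) : Prop :=
  exists2 p : F * F, p \in Disc F & L = tangent_at p.

Definition bracket (F : finFieldType) (f g : {poly F}) : {poly F} :=
  f^`() * g - f * g^`().

(* size = degree + 1: the bracket has degree less than 2. *)
Definition aligned (F : finFieldType) (P Q : F * F) : Prop :=
  (size (bracket (quad P) (quad Q)) <= 2)%N.

Definition dfrak (F : finFieldType) (u v w : F * F) : F :=
  \det (\matrix_(i < 3, j < 3)
    (nth [::] [:: [:: u.2; u.1; 1]; [:: v.2; v.1; 1]; [:: w.2; w.1; 1]] i)`_j).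

(* Main.v *)
Require Import Defs.
From HB Require Import structures.
From mathcomp Require Import all_boot all_order all_algebra all_field.
From mathcomp Require Import fingroup cyclic ring.

Import GRing.Theory.
Local Open Scope ring_scope.

(** A root x of two distinct monic quadratics x^2 + a x + b and x^2 + a' x + b'
    satisfies (a - a') x = b' - b.  Here a <> a', since a = a' would force
    b = b'; hence x is a quotient of elements of F and the common root is
    rational ([common_root_rational]).  A rational common root r says that both
    points lie on T_r, the line b = - r a - r^2 ([in_Tline]), and T_r is the
    tangent to the parabola at (-2r, r^2); every tangent arises this way because
    2 is invertible ([Tline_tangent], [tangent_Tline]).  Two distinct points
    determine the line on which they lie, so lying on T_r means that T_r is the
    line PQ ([line_through_Tline]).

    The bracket of the two quadratics has x^2-coefficient a' - a and no term of
    higher degree, so being aligned means a = a', that is, being on one vertical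
    line.  Lastly, up to sign the determinant d(A, B, C) is the cross product of
    B - A and C - A, whose vanishing is the equation of the line AB in the
    unknown C ([in_line_through], [dfrakE]). *)

(** * Points, lines and the determinant *)

Section Plane.
Set Implicit Arguments.
Unset Strict Implicit.
Variable F : finFieldType.
Implicit Types (P Q A B C p x : F * F) (r c : F).

(** The equation says that x - P and Q - P are parallel; distinctness of P and Q
    provides a nonzero coordinate of Q - P by which to divide to recover the
    parameter. *)
Lemma in_line_through P Q x : P != Q ->
  (x \in line_through P Q) =
    ((x.1 - P.1) * (Q.2 - P.2) == (x.2 - P.2) * (Q.1 - P.1)).
Proof.
case: P Q x => [a b] [c d] [e f] /= PQ; apply/imsetP/eqP => /= [[t _ [-> ->]]|H].
  by ring.
have [ac|ac] := eqVneq (c - a) 0.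
  have db : d - b != 0.
    apply: contraNneq PQ => /subr0_eq ->; move/subr0_eq: ac => ->.
    by [].
  exists ((f - b) / (d - b)) => //; rewrite ac mulr0 addr0 divfK // subrKC.
  move/eqP: H; rewrite ac mulr0 mulf_eq0 (negPf db) orbF subr_eq0.
  by move/eqP ->.
exists ((e - a) / (c - a)) => //; rewrite divfK // mulrAC H mulfK //.
by rewrite !subrKC.
Qed.

Lemma line_through_left P Q : P \in line_through P Q.
Proof. by apply/imsetP; exists 0 => //; rewrite !mul0r !addr0 -surjective_pairing. Qed.

Lemma line_through_right P Q : Q \in line_through P Q.
Proof.
by apply/imsetP; exists 1 => //; rewrite !mul1r !subrKC -surjective_pairing.
Qed.

Lemma dfrakE A B C :
  dfrak A B C = (C.1 - A.1) * (B.2 - A.2) - (C.2 - A.2) * (B.1 - A.1).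
Proof.
rewrite /dfrak (expand_det_row _ ord0) !big_ord_recl big_ord0 /cofactor.
rewrite !(expand_det_row _ ord0) !big_ord_recl !big_ord0 /cofactor !det_mx11.
by rewrite !mxE /=; ring.
Qed.

Lemma dfrak_collinear A B C : A != B -> dfrak A B C = 0 <-> collinear A B C.
Proof.
move=> AB; split=> [/eqP|[P [Q [_ []]]]].
  rewrite dfrakE subr_eq0 -in_line_through // => CAB.
  by exists A, B; rewrite line_through_left line_through_right.
move=> /imsetP[s _ ->] /imsetP[t _ ->] /imsetP[u _ ->].
by rewrite dfrakE /=; ring.
Qed.

Lemma vertical_line_through P Q : P != Q ->
  P.1 = Q.1 <-> vertical (line_through P Q).
Proof.
move=> PQ; split=> [e|[c L]]; last first.
  have := line_through_left P Q; have := line_through_right P Q.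
  by rewrite L !inE => /eqP-> /eqP->.
exists P.1; apply/setP=> x; rewrite in_line_through // inE -e subrr mulr0.
rewrite mulf_eq0 !subr_eq0; case: (eqVneq Q.2 P.2) => [e2|_]; last by rewrite orbF.
by rewrite (surjective_pairing P) (surjective_pairing Q) e e2 eqxx in PQ.
Qed.

(** * Roots and brackets of quadratics *)

Lemma in_Tline r p : (p \in Tline r) = (r ^+ 2 + p.1 * r + p.2 == 0).
Proof. by rewrite inE dvdp_XsubCl /root /quad !hornerE. Qed.

Lemma Tline_fst_neq r P Q :
  P != Q -> P \in Tline r -> Q \in Tline r -> P.1 != Q.1.
Proof.
case: P Q => [a b] [c d]; rewrite !in_Tline /= => PQ /eqP HP /eqP HQ.
apply: contraNneq PQ => e; rewrite e; rewrite e in HP.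
by have /addrI -> := etrans HP (esym HQ).
Qed.

Lemma line_through_Tline r P Q :
  P != Q -> P \in Tline r -> Q \in Tline r -> line_through P Q = Tline r.
Proof.
move=> PQ PT QT; have := Tline_fst_neq PQ PT QT.
move: PT QT; rewrite !in_Tline => /eqP PT /eqP QT ne.
apply/setP=> x; rewrite in_line_through // in_Tline.
have eP : P.2 = - (r ^+ 2 + P.1 * r) by apply/eqP; rewrite -addr_eq0 addrC PT.
have eQ : Q.2 = - (r ^+ 2 + Q.1 * r) by apply/eqP; rewrite -addr_eq0 addrC QT.
rewrite -subr_eq0 eP eQ.
(* On T_r the two sides of the equation of PQ differ by the value at r of the
   quadratic x, times the nonzero P.1 - Q.1. *)
have -> : (x.1 - P.1) * (- (r ^+ 2 + Q.1 * r) - - (r ^+ 2 + P.1 * r)) -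
    (x.2 - - (r ^+ 2 + P.1 * r)) * (Q.1 - P.1) =
    (P.1 - Q.1) * (r ^+ 2 + x.1 * r + x.2) by ring.
by rewrite mulf_eq0 subr_eq0 (negPf ne).
Qed.

Lemma bracket_quad P Q :
  bracket (quad P) (quad Q) =
    (Q.1 - P.1) *: 'X^2 + (2%:R * (Q.2 - P.2)) *: 'X
      + (P.1 * Q.2 - Q.1 * P.2)%:P.
Proof.
rewrite /bracket /quad !derivE -!mul_polyC !(polyCB, polyCM, polyCN, polyC_natr).
by ring.
Qed.

Lemma aligned_fst P Q : aligned P Q <-> P.1 = Q.1.
Proof.
rewrite /aligned bracket_quad; split=> [/leq_sizeP/(_ 2 isT)|->].
  by rewrite !(coefD, coefZ, coefXn, coefX, coefC) /= mulr1 mulr0 !addr0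
     => /subr0_eq.
rewrite subrr scale0r add0r (leq_trans (size_polyD _ _)) // geq_max.
rewrite (leq_trans (size_scale_leq _ _)) ?size_polyX //=.
by rewrite (leq_trans (size_polyC_leq1 _)).
Qed.

(** The common root, if any, is (Q.2 - P.2) / (P.1 - Q.1), computed in F. *)
Lemma common_root_rational (K : closedFieldType) (iota : {rmorphism F -> K})
    P Q : P != Q ->
  common_root iota (quad P) (quad Q) <->
    exists r : F, P \in Tline r /\ Q \in Tline r.
Proof.
move=> PQ; split=> [[x []]|[r [PT QT]]]; last first.
  move: PT QT; rewrite !inE !dvdp_XsubCl => PT QT.
  by exists (iota r); rewrite !fmorph_root.
have evalE p : (map_poly iota (quad p)).[x] = x ^+ 2 + iota p.1 * x + iota p.2.
  by rewrite /quad !rmorphD /= map_polyXn map_polyZ map_polyX map_polyC !hornerE.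
move=> rP rQ; have ne : P.1 - Q.1 != 0.
  apply: contraNneq PQ => /subr0_eq e1.
  move: rP rQ; rewrite /root !evalE e1 => /eqP HP /eqP HQ.
  have /addrI/fmorph_inj e2 := etrans HP (esym HQ).
  by rewrite (surjective_pairing P) (surjective_pairing Q) e1 e2.
have [y xy] : exists y, x = iota y.
  exists ((Q.2 - P.2) / (P.1 - Q.1)); rewrite fmorph_div.
  apply: (canRL (mulfK _)); first by rewrite fmorph_eq0.
  move: rP rQ; rewrite /root !evalE !rmorphB => /eqP HP /eqP HQ.
  apply/eqP; rewrite -subr_eq0; apply/eqP.
  rewrite -[RHS](subrr 0) -{1}HP -HQ; ring.
by exists y; rewrite !inE !dvdp_XsubCl -!(fmorph_root iota) -xy.
Qed.

(** * Tangents of the discriminant parabola *)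

Lemma odd_card_natr2_neq0 : odd #|F| -> 2%:R != 0 :> F.
Proof.
move=> hodd; apply/eqP => two0.
(* The order of the additive group kills 1. *)
have card0 : #|F|%:R = 0 :> F.
  have := expg_cardG (in_setT (1 : F)).
  by rewrite cardsT FinRing.zmodXgE FinRing.zmod1gE.
move: card0; rewrite -[#|F|]odd_double_half hodd natrD -mul2n natrM two0 mul0r.
by rewrite addr0 => /eqP; rewrite oner_eq0.
Qed.

Hypothesis hodd : odd #|F|.

Lemma odd_card_natr4_neq0 : 4%:R != 0 :> F.
Proof. by rewrite (natrM _ 2 2) mulf_neq0 // odd_card_natr2_neq0. Qed.

Lemma in_Disc p : (p \in Disc F) = (p.2 == (p.1 / 2%:R) ^+ 2).
Proof.
have two := odd_card_natr2_neq0 hodd.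
have four := odd_card_natr4_neq0.
by rewrite inE /parab hornerZ hornerXn; congr (_ == _); field; rewrite two.
Qed.

Lemma horner_deriv_parab c : (parab F)^`().[c] = c / 2%:R.
Proof.
have two := odd_card_natr2_neq0 hodd.
have four := odd_card_natr4_neq0.
by rewrite /parab derivZ derivXn hornerZ hornerMn expr1 hornerX /=; field; rewrite two.
Qed.

(** Completing the square: the abscissa of a point of tangency is minus twice
    the double root. *)
Lemma tangent_Tline p : p \in Disc F -> tangent_at p = Tline (- (p.1 / 2%:R)).
Proof.
have two := odd_card_natr2_neq0 hodd.
rewrite in_Disc => /eqP p2; apply/setP=> x.
rewrite in_Tline inE horner_deriv_parab p2 -subr_eq0; congr (_ == 0).
by field.
Qed.

Lemma Tline_tangent r : tangent_to_Disc (Tline r).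
Proof.
have two := odd_card_natr2_neq0 hodd.
have half : - (- (2%:R * r) / 2%:R) = r by field.
have pD : (- (2%:R * r), r ^+ 2) \in Disc F.
  by rewrite in_Disc /= -[in X in _ == X]sqrrN half.
by exists (- (2%:R * r), r ^+ 2); rewrite // tangent_Tline //= half.
Qed.

Lemma Tline_line_through_tangent P Q : P != Q ->
  (exists r : F, P \in Tline r /\ Q \in Tline r) <->
    tangent_to_Disc (line_through P Q).
Proof.
move=> PQ; split=> [[r [PT QT]]|[p pD L]].
  by rewrite (line_through_Tline PQ PT QT); apply: Tline_tangent.
exists (- (p.1 / 2%:R)); rewrite -tangent_Tline // -L.
by rewrite line_through_left line_through_right.
Qed.

End Plane.

Theorem lemma5p5 (F : finFieldType) (hodd : odd #|F|)
    (K : closedFieldType) (iota : {rmorphism F -> K})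
    (hK : is_algebraic_closure iota) :
  (forall P Q : F * F, P \in Sep F -> Q \in Sep F -> P != Q ->
    [/\ common_root iota (quad P) (quad Q) <->
          (exists r : F, P \in Tline r /\ Q \in Tline r),
        (exists r : F, P \in Tline r /\ Q \in Tline r) <->
          tangent_to_Disc (line_through P Q)
      & aligned P Q <-> vertical (line_through P Q)]) /\
  (forall A B C : F * F, A \in Sep F -> B \in Sep F -> C \in Sep F ->
    A != B -> A != C -> B != C ->
    (dfrak A B C = 0 <-> collinear A B C)).
Proof.
split=> [P Q _ _ PQ | A B C _ _ _ AB _ _]; last exact: dfrak_collinear.
split; first exact: common_root_rational.
  exact: Tline_line_through_tangent.
by rewrite aligned_fst; apply: vertical_line_through.
Qed.
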